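(* Let $(W,S)$ be an affine Coxeter group and let $w\in W$. Then the annex $\mathrm{Annex}(w)=\{y\in W : w\not\leq y\}$ is a finite set.
   Context: A Coxeter system $(W,S)$ has presentation $\langle s_i, i\in I \mid (s_is_j)^{m_{ij}}=1\rangle$ with $m_{ii}=1$ and $m_{ij}\in\mathbb{Z}_{\ge 2}\cup\{\infty\}$ for $i\neq j$. An affine Coxeter group is an infinite Coxeter group having a normal abelian subgroup of finite index (equivalently, an affine Weyl group of a crystallographic root system). $\leq$ denotes the Bruhat order: $x\le y$ iff some (equivalently every) reduced expression of $y$ contains a subword that is a reduced expression of $x$. The annex of $w$ is $\mathrm{Annex}(w)=\{y\in W: w\not\le y\}$, the complement of the upper Bruhat interval $[w,\infty)$.
   Formalization: The affine Coxeter group is assumed irreducible (connected Coxeter graph) and of finite rank; otherwise the claim fails, e.g. in D_∞ × Z/2 the annex of the Z/2 generator contains all of D_∞, and in infinite rank the annex of a generator contains all other generators. *)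

(* Defs.v *)
From mathcomp Require Import all_boot.
From Stdlib Require Import Relation_Operators.
Set Implicit Arguments. Unset Strict Implicit. Unset Printing Implicit Defensive.

Section Coxeter.
Variable I : finType.
(* Coxeter matrix: m i j : nat, with the convention  0  encoding  infinity. *)
Variable m : I -> I -> nat.

Definition coxeter_matrix : Prop :=
  forall i j, m i j = m j i /\ (m i j = 1 <-> i = j).

Definition relator (i j : I) : seq I := flatten (nseq (m i j) [:: i; j]).

Definition cox_step (u v : seq I) : Prop :=
  exists a b i j, 0 < m i j /\ u = a ++ relator i j ++ b /\ v = a ++ b.

(* equality in W = < s_i | (s_i s_j)^(m_ij) = 1 > of the elements represented
   by two words (the monoid congruence generated by the relators; since every
   s_i is an involution, this is the group W) *)
Definition cox_eq : seq I -> seq I -> Prop := clos_refl_sym_trans _ cox_step.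

Definition reduced (u : seq I) : Prop :=
  forall v, cox_eq u v -> size u <= size v.

(* Bruhat order (subword property as the definition) *)
Definition bruhat_le (x y : seq I) : Prop :=
  exists ry, [/\ reduced ry, cox_eq ry y &
    exists rx, [/\ subseq rx ry, reduced rx & cox_eq rx x]].

Definition Annex (w : seq I) : seq I -> Prop := fun y => ~ bruhat_le w y.

Definition finite_in_W (P : seq I -> Prop) : Prop :=
  exists L : seq (seq I), forall y, P y -> exists2 l, l \in L & cox_eq l y.

Definition W_infinite : Prop := ~ finite_in_W (fun _ => True).

Definition normal_abelian_finite_index (H : seq I -> Prop) : Prop :=
  (forall u v, cox_eq u v -> H u -> H v) /\
  H [::] /\
  (forall u v, H u -> H v -> H (u ++ v)) /\
  (forall u, H u -> H (rev u)) /\             (* rev u represents u^-1 *)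
  (forall g h, H h -> H (g ++ h ++ rev g)) /\
  (forall u v, H u -> H v -> cox_eq (u ++ v) (v ++ u)) /\
  (exists L : seq (seq I), forall g, exists2 l, l \in L & H (rev l ++ g)).

Definition coxeter_graph : rel I := fun i j => (i != j) && (m i j != 2).
Definition irreducible : Prop := forall i j, connect coxeter_graph i j.

Definition affine_coxeter : Prop :=
  [/\ coxeter_matrix, irreducible, W_infinite &
      exists H, normal_abelian_finite_index H].
End Coxeter.

(* Main.v *)
(* In an irreducible virtually abelian Coxeter group every proper standard
   parabolic subgroup is finite, so there is an N such that each factor of
   length N of a reduced word contains every letter.  A reduced word of length
   at least N * l(w) then contains a reduced word of w as a subword, so the
   elements not above w have length less than N * l(w).

   Finiteness of the parabolic subgroups: let H be the normal abelian subgroup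
   and let h in H be a word avoiding the letter s.  The parity of wall crossings
   shows that h^2 commutes with s, and therefore is a word in letters commuting
   with s.  Since the Coxeter graph is connected, iterating this gives
   h^(2^k) = 1.  In a long word avoiding s one can then delete enough equal
   conjugates lying in H to see that it is not reduced. *)
Require Import Defs.
From mathcomp Require Import all_boot.
From mathcomp Require Import all_algebra all_field boolp ring.
From Stdlib Require Import Relation_Operators Setoid Morphisms.
Set Implicit Arguments. Unset Strict Implicit. Unset Printing Implicit Defensive.
Import GRing.Theory Num.Theory.

Section Words.
Variables (I : finType) (m : I -> I -> nat).
Hypothesis mP : coxeter_matrix m.
Local Notation "u ≃ v" := (cox_eq m u v) (at level 70).
Implicit Types (i j r s : I) (u v w t g h a b p : seq I).

(** * Words modulo the Coxeter relations as a group *)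

Lemma mC i j : m i j = m j i. Proof. by case: (mP i j). Qed.
Lemma mii i : m i i = 1. Proof. by case: (mP i i) => _ [_ ->]. Qed.

#[local] Instance cox_eq_equiv : Equivalence (cox_eq m).
Proof.
split.
- by move=> u; exact: rst_refl.
- by move=> u v; exact: rst_sym.
- by move=> u v w; exact: rst_trans.
Qed.

Lemma cox_eq_ctx a b u v : u ≃ v -> a ++ u ++ b ≃ a ++ v ++ b.
Proof.
elim=> {u v} [u v [a' [b' [i [j [mij [-> ->]]]]]]|u|u v _|u v w _ + _] //; try reflexivity.
- apply: rst_step; exists (a ++ a'), (b' ++ b), i, j; split=> //.
  by rewrite -!catA.
- by symmetry.
- by move=> ->.
Qed.

#[local] Instance cat_proper : Proper (cox_eq m ==> cox_eq m ==> cox_eq m) (@cat I).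
Proof.
move=> u u' uu v v' vv; transitivity (u' ++ v).
  exact: (cox_eq_ctx [::] v uu).
by have := cox_eq_ctx u' [::] vv; rewrite !cats0.
Qed.

Lemma rev_relator i j : rev (relator m i j) = relator m j i.
Proof.
rewrite /relator mC; elim: (m j i) => //= n IH.
by rewrite !rev_cons IH -!cats1 -catA; elim: n {IH} => //= n ->.
Qed.

#[local] Instance cons_proper i : Proper (cox_eq m ==> cox_eq m) (cons i).
Proof. by move=> u v uv; apply: (@cat_proper [:: i] [:: i] _ _ _ uv); reflexivity. Qed.

#[local] Instance rev_proper : Proper (cox_eq m ==> cox_eq m) (@rev I).
Proof.
move=> u v; elim=> {u v} [u v [a [b [i [j [mij [-> ->]]]]]]|u|u v _|u v w _ + _] //; try reflexivity.
- apply: rst_step; exists (rev b), (rev a), j, i.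
  by rewrite mC !rev_cat rev_relator -catA.
- by symmetry.
- by move=> ->.
Qed.

Lemma relator1 i j : relator m i j ≃ [::].
Proof.
case E: (m i j) => [|n]; first by rewrite /relator E; reflexivity.
by apply: rst_step; exists [::], [::], i, j; rewrite cats0 E.
Qed.

Lemma letter_sqr i : [:: i] ++ [:: i] ≃ [::].
Proof. by have := relator1 i i; rewrite /relator mii. Qed.

Lemma mulKrev u v : u ++ rev u ++ v ≃ v.
Proof.
elim: u v => [|i u IH] v; first reflexivity.
rewrite rev_cons -cats1 -catA -cat1s -catA IH catA letter_sqr; reflexivity.
Qed.

Lemma mulrevK u v : rev u ++ u ++ v ≃ v.
Proof. by have := mulKrev (rev u) v; rewrite revK. Qed.

Lemma mulKrev0 u : u ++ rev u ≃ [::].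
Proof. by have := mulKrev u [::]; rewrite cats0. Qed.

Lemma mulrevK0 u : rev u ++ u ≃ [::].
Proof. by have := mulrevK u [::]; rewrite cats0. Qed.

Lemma letterK i u : [:: i] ++ [:: i] ++ u ≃ u.
Proof. exact: mulKrev [:: i] u. Qed.

Lemma mulI g u v : g ++ u ≃ g ++ v -> u ≃ v.
Proof. by move=> E; rewrite -(mulrevK g u) E mulrevK; reflexivity. Qed.

Lemma mulIr g u v : u ++ g ≃ v ++ g -> u ≃ v.
Proof.
move=> E; rewrite -(cats0 u) -(cats0 v) -(mulKrev0 g) !catA E; reflexivity.
Qed.

(** * Wall crossings and the exchange property *)

(* The parity of the number of times a gallery of type u from the identity
   crosses the wall of the reflection t. *)
Fixpoint eta u t : bool :=
  if u is i :: u' then `[< [:: i] ≃ t >] (+) eta u' ([:: i] ++ t ++ [:: i])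
  else false.

Lemma asbool_cox u v u' v' : u ≃ u' -> v ≃ v' -> `[< u ≃ v >] = `[< u' ≃ v' >].
Proof. by move=> uu vv; apply: asbool_equiv_eq; rewrite uu vv. Qed.

Lemma eta_congr u t t' : t ≃ t' -> eta u t = eta u t'.
Proof.
elim: u t t' => //= i u IH t t' tt; congr (_ (+) _).
  by apply: asbool_cox => //; reflexivity.
apply: IH; exact: (cox_eq_ctx [:: i] [:: i] tt).
Qed.

Lemma eta_cat u v t : eta (u ++ v) t = eta u t (+) eta v (rev u ++ t ++ u).
Proof.
elim: u t => [|i u IH] t /=; first by rewrite cats0.
by rewrite IH addbA rev_cons cat_rcons /= -catA.
Qed.

(** Counting from 0, the k-th wall crossed belongs to the k-th letter conjugated by the prefix
    before it. This is an alternating word of length 2k+1, namely (ij)^k i. *)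
Lemma eta_dihedral i j n t :
  eta (flatten (nseq n [:: i; j])) t =
  \big[addb/false]_(k < n + n) `[< flatten (nseq k [:: i; j]) ++ [:: i] ≃ t >].
Proof.
elim: n t => [|n IH] t; first by rewrite big_ord0.
rewrite addSn addnS !big_ord_recl [LHS]/= IH; congr (_ (+) (_ (+) _)).
  apply: asbool_equiv_eq; split=> [E|<-].
    change ([:: i] ++ [:: j] ++ [:: i] ≃ t); rewrite E.
    change ([:: i] ++ ([:: i] ++ t ++ [:: i]) ++ [:: i] ≃ t).
    by rewrite -!catA letterK letter_sqr cats0; reflexivity.
  change ([:: j] ≃ [:: i] ++ [:: i] ++ [:: j] ++ [:: i] ++ [:: i]).
  by rewrite letterK letter_sqr; reflexivity.
apply: eq_bigr => k _; rewrite !lift0.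
set x := flatten _; have xr : x ++ [:: i; j] = [:: i; j] ++ x.
  by rewrite /x; elim: (k : nat) => //= l IHl; rewrite IHl.
have -> : flatten (nseq k.+2 [:: i; j]) ++ [:: i] =
   [:: i; j] ++ (x ++ [:: i]) ++ rev [:: i; j].
  rewrite -catA; change ([:: i; j] ++ ([:: i; j] ++ x) ++ [:: i] =
    [:: i; j] ++ x ++ [:: i; j] ++ [:: i]).
  by rewrite (catA x) xr.
have -> : [:: j, i & (t ++ [:: i]) ++ [:: j]] = rev [:: i; j] ++ t ++ [:: i; j].
  by rewrite /= -catA.
apply: asbool_equiv_eq; split=> [->|<-]; rewrite -!catA.
  by rewrite mulKrev mulKrev0 cats0; reflexivity.
by rewrite mulrevK mulrevK0 !cats0; reflexivity.
Qed.

(** Since (ij)^m = 1 for m = [m i j], the reflections (ij)^k i with k < 2m repeat with period m and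
    cancel in pairs. *)
Lemma eta_relator i j t : eta (relator m i j) t = false.
Proof.
rewrite {1}/relator eta_dihedral big_split_ord /= -big_split big1 // => k _ /=.
rewrite [X in _ (+) X](_ : _ = `[< flatten (nseq k [:: i; j]) ++ [:: i] ≃ t >]) ?addbb //.
apply: asbool_cox; last reflexivity.
rewrite nseqD flatten_cat -catA -/(relator m i j) relator1; reflexivity.
Qed.

Lemma eta_cox_eq u v t : u ≃ v -> eta u t = eta v t.
Proof.
move=> uv; elim: uv t => {u v} // [u v [a [b [i [j [mij [-> ->]]]]]] t|u v w _ IH1 _ IH2 t].
  rewrite !eta_cat eta_relator /=; congr (_ (+) _); apply: eta_congr.
  by rewrite rev_relator !relator1 cats0; reflexivity.
by rewrite IH1.
Qed.

(** Deleting a letter of [u] at which the wall of [t] is crossed multiplies [u] by [t] on the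
    left. *)
Lemma exchange u t : eta u t ->
  exists u', [/\ subseq u' u, size u' < size u & u' ≃ t ++ u].
Proof.
elim: u t => //= i u IH t.
case: asboolP => [it _|_ /= /IH [u' [su szu E]]].
  exists u; split=> //; first exact: subseq_cons.
  by rewrite -it -(cat1s i u) letterK; reflexivity.
exists (i :: u'); split=> //=; first by rewrite eqxx.
rewrite E; change ([:: i] ++ ([:: i] ++ t ++ [:: i]) ++ u ≃ t ++ [:: i] ++ u).
by rewrite -!catA letterK; reflexivity.
Qed.

(** Membership in a standard parabolic subgroup. *)
Definition represented (P : pred I) t := exists2 v, all P v & v ≃ t.

(** Every wall crossed by [u] belongs to a letter of [u] conjugated by a prefix of [u]. *)
Lemma eta_unrepresented (P : pred I) u t :
  all P u -> ~ represented P t -> eta u t = false.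
Proof.
elim: u t => //= i u IH t /andP[Pi Pu] nt.
case: asboolP => [it|_] /=; first by case: nt; exists [:: i]; rewrite //= Pi.
apply: IH => // -[v Pv E]; apply: nt; exists ([:: i] ++ v ++ [:: i]).
  by rewrite !all_cat Pv /= Pi.
rewrite E; change ([:: i] ++ ([:: i] ++ t ++ [:: i]) ++ [:: i] ≃ t).
by rewrite -!catA letterK letter_sqr cats0; reflexivity.
Qed.

(** * The dual geometric representation *)

(* A linear representation on functions on I, dual to the geometric one.  Only
   the relations and the vanishing of cartan i j matter here, so any primitive
   root of unity of order 2 m_ij serves in place of exp(i pi / m_ij). *)
Local Open Scope ring_scope.

Definition root_of_unity (n : nat) : algC :=
  if n is n'.+1 then sval (C_prim_root_exists (ltn0Sn n')) else 1.

Lemma root_of_unityP n : (0 < n)%N -> n.-primitive_root (root_of_unity n).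
Proof. by case: n => // n _; rewrite /root_of_unity; case: C_prim_root_exists. Qed.

Lemma root_of_unity_neq0 n : (0 < n)%N -> root_of_unity n != 0.
Proof.
move=> n0; have := prim_expr_order (root_of_unityP n0).
case: eqVneq => // ->; rewrite expr0n gtn_eqF // => /eqP.
by rewrite eq_sym oner_eq0.
Qed.

(** Twice the Tits form, up to the choice of root: -2 cos(pi / m_ij) off the diagonal, and -2 when
    m_ij is infinite. *)
Definition cartan i j : algC :=
  if i == j then 2 else if m i j == 0%N then - 2 else
  - (root_of_unity (m i j).*2 + (root_of_unity (m i j).*2)^-1).

Lemma cartanii i : cartan i i = 2. Proof. by rewrite /cartan eqxx. Qed.

Lemma cartanC i j : cartan i j = cartan j i.
Proof. by rewrite /cartan eq_sym mC. Qed.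

Lemma m_gt1 i j : i != j -> (0 < m i j)%N -> (1 < m i j)%N.
Proof.
move=> /eqP ij; case E: (m i j) => [|[|n]] // _.
by case: ij; case: (mP i j) => _ [] ->.
Qed.

(** If the entry vanishes, the root squares to -1, so its order 2 m_ij divides 4. *)
Lemma cartan_eq0 i j : i != j -> cartan i j = 0 -> m i j = 2.
Proof.
move=> ij; rewrite /cartan (negPf ij); have [_|m0] := eqVneq (m i j) 0%N.
  by move/eqP; rewrite oppr_eq0 pnatr_eq0.
rewrite -lt0n in m0; have m1 := m_gt1 ij m0.
have z0 : root_of_unity (m i j).*2 != 0 by rewrite root_of_unity_neq0 ?double_gt0.
have zP : ((m i j).*2).-primitive_root (root_of_unity (m i j).*2).
  by apply: root_of_unityP; rewrite double_gt0.
set z := root_of_unity _ in z0 zP *.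
move/eqP; rewrite oppr_eq0 => /eqP E.
have z2 : z ^+ 2 = -1.
  by apply/eqP; rewrite -subr_eq0 opprK -(mulfV z0) expr2 -mulrDr E mulr0.
have : ((m i j).*2 %| 4)%N.
  by rewrite (prim_order_dvd zP) (exprM z 2 2) z2 sqrrN expr1n.
by move=> /dvdn_leq -/(_ isT); rewrite -[4%N]/(2.*2)%N leq_double => ?; apply/eqP; rewrite eqn_leq m1 andbT.
Qed.

Definition refl_act i (f : {ffun I -> algC}) : {ffun I -> algC} :=
  [ffun k => f k - cartan i k * f i].

Definition act u f := foldr refl_act f u.

Lemma act_cat u v f : act (u ++ v) f = act u (act v f).
Proof. by rewrite /act foldr_cat. Qed.

Lemma refl_actK i f : refl_act i (refl_act i f) = f.
Proof. by apply/ffunP => k; rewrite !ffunE cartanii; ring. Qed.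

(** For distinct letters, the total multiples subtracted are sums of m_ij successive powers of z^2
    and z^-2, which are m_ij-th roots of unity other than 1; these sums vanish. *)
Lemma act_relator i j f : (0 < m i j)%N -> act (relator m i j) f = f.
Proof.
move=> m0; rewrite /relator.
have [<-|ij] := eqVneq i j; first by rewrite mii /= refl_actK.
have m1 := m_gt1 ij m0.
have ctr : cartan i j = - (root_of_unity (m i j).*2 + (root_of_unity (m i j).*2)^-1).
  by rewrite /cartan (negPf ij) gtn_eqF.
have z0 : root_of_unity (m i j).*2 != 0 by rewrite root_of_unity_neq0 ?double_gt0.
have zP : ((m i j).*2).-primitive_root (root_of_unity (m i j).*2).
  by apply: root_of_unityP; rewrite double_gt0.
set z := root_of_unity _ in z0 zP ctr.
have z2 : z ^+ 2 != 1.
  rewrite -(prim_order_dvd zP); apply/negP => /dvdn_leq -/(_ isT).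
  by rewrite -[X in (_ <= X)%N]/(1.*2)%N leq_double leqNgt m1.
have zz : z - z^-1 != 0.
  apply: contra z2 => /eqP E; rewrite -subr_eq0 -(mulfV z0) expr2 -mulrBr E.
  by rewrite mulr0.
(* [A] and [B] are fitted to the first two subtracted scalars, computed in [y0] and [y1]. *)
pose B := (z * f j - (f i - cartan i j * f j)) / (z - z^-1).
pose A := f j - B.
(* y n is the scalar subtracted at the n-th reflection; it satisfies the
   recurrence y (n+2) = - cartan i j * y (n+1) - y n. *)
pose y n := A * z ^+ n + B * z^-1 ^+ n.
have y0 : y 0%N = f j by rewrite /y /A !expr0 !mulr1 subrK.
have y1 : y 1%N = f i - cartan i j * f j.
  by rewrite /y /A !expr1 mulrBl addrAC -addrA -mulrBr -opprB mulrN /B divfK //; ring.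
have yr n : y n.+2 = - cartan i j * y n.+1 - y n.
  rewrite ctr /y !exprS; field; exact: z0.
have actn n : act (flatten (nseq n [:: i; j])) f =
   [ffun k => f k - cartan j k * (\sum_(l < n) y l.*2) - cartan i k * \sum_(l < n) y l.*2.+1]
  /\ act (flatten (nseq n [:: i; j])) f j = y n.*2
  /\ act (flatten (nseq n [:: i; j])) f i = y n.*2.+1 + cartan i j * y n.*2.
  elim: n => [|n [IH [IHj IHi]]].
    rewrite y0 y1 subrK; split=> //=.
    by apply/ffunP => k; rewrite ffunE !big_ord0 !mulr0 !subr0.
  have stepi : act (flatten (nseq n.+1 [:: i; j])) f =
    refl_act i (refl_act j (act (flatten (nseq n [:: i; j])) f)) by [].
  rewrite stepi; move: IH IHj IHi; set g := act _ f => IH IHj IHi.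
  rewrite !ffunE IHj IHi (cartanC j i) !cartanii; split.
    by apply/ffunP => k; rewrite !ffunE IHj IHi IH ffunE !big_ord_recr /= (cartanC j i); ring.
  by rewrite doubleS !yr; split; ring.
have [-> _] := actn (m i j).
have sum0 (x : algC) : x ^+ (m i j) = 1 -> x != 1 -> \sum_(l < m i j) x ^+ l = 0.
  move=> xm x1; apply/eqP; have := subrX1 x (m i j); rewrite xm subrr => /esym/eqP.
  by rewrite mulf_eq0 subr_eq0 (negPf x1).
have zm : (z ^+ 2) ^+ (m i j) = 1 by rewrite -exprM mul2n prim_expr_order.
have zi2 : z^-1 ^+ 2 != 1 by rewrite exprVn invr_eq1.
have zim : (z^-1 ^+ 2) ^+ (m i j) = 1 by rewrite exprVn exprVn zm invr1.
apply/ffunP => k; rewrite !ffunE.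
have -> : \sum_(l < m i j) y l.*2 = 0.
  rewrite big_split /= -!mulr_sumr.
  under eq_bigr => l _ do rewrite -mul2n exprM.
  rewrite (sum0 _ zm) // mulr0 add0r.
  under eq_bigr => l _ do rewrite -mul2n exprM.
  by rewrite (sum0 _ zim) // mulr0.
have -> : \sum_(l < m i j) y l.*2.+1 = 0.
  rewrite big_split /= -!mulr_sumr.
  under eq_bigr => l _ do rewrite exprS -mul2n exprM.
  rewrite -mulr_sumr (sum0 _ zm) // !mulr0 add0r.
  under eq_bigr => l _ do rewrite exprS -mul2n exprM.
  by rewrite -mulr_sumr (sum0 _ zim) // !mulr0.
by rewrite !mulr0 !subr0.
Qed.

Lemma act_cox_eq u v f : u ≃ v -> act u f = act v f.
Proof.
move=> uv; elim: uv f => {u v} // [u v [a [b [i [j [mij [-> ->]]]]]] f|u v w _ IH1 _ IH2 f].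
  by rewrite !act_cat act_relator.
by rewrite IH1.
Qed.

(** The fundamental coweight at [s]: fixed by every other letter, moved by [s], so it detects
    elements outside the parabolic subgroup omitting [s]. *)
Definition indicator s : {ffun I -> algC} := [ffun k => (k == s)%:R].

Lemma act_indicator s u : all (predC1 s) u -> act u (indicator s) = indicator s.
Proof.
elim: u => //= i u IH /andP[/negPf ns /IH ->].
by apply/ffunP => k; rewrite !ffunE ns mulr0 subr0.
Qed.

Lemma letter_unrepresented s : ~ represented (predC1 s) [:: s].
Proof.
case=> v /act_indicator E /(act_cox_eq (indicator s)); rewrite {}E.
move/ffunP/(_ s); rewrite !ffunE eqxx mulr1 cartanii => /eqP.
by rewrite -subr_eq0 opprB addrCA subrr addr0 pnatr_eq0.
Qed.

(** The word s r s changes the value of [indicator s] at [s] from 1 to 1 - ([cartan r s])^2. *)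
Lemma conj_letter_represented r s :
  r != s -> represented (predC1 s) [:: s; r; s] -> m r s = 2.
Proof.
move=> rs [v /act_indicator E /(act_cox_eq (indicator s))]; rewrite {}E.
move/ffunP/(_ s); rewrite !ffunE eqxx !mulr1 (negPf rs) (cartanC s r).
rewrite cartanii => /eqP E; apply: cartan_eq0 => //; apply/eqP; move: E.
rewrite mulr1n mulr0n -subr_eq0 (_ : _ - _ = cartan r s ^+ 2) ?expf_eq0 //; ring.
Qed.

Local Close Scope ring_scope.

(** * Parabolic elements commuting with an omitted letter *)

Lemma notin_all s u : s \notin u -> all (predC1 s) u.
Proof. by move=> su; apply/allP => y yu /=; apply: contraNneq su => <-. Qed.

(* Peeling the first letter r off a shortest such word: the reflection r
   separates the identity from u, hence so does s r s, which therefore lies in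
   the parabolic subgroup generated by the letters other than s. *)
Lemma commuting_letters s u : s \notin u -> [:: s] ++ u ≃ u ++ [:: s] ->
  exists v, [/\ v ≃ u, {subset v <= u} & all (fun r => m r s == 2) v].
Proof.
have [n] := ubnP (size u); elim: n u => // n IH [|r u] /=.
  by move=> _ _ _; exists [::]; split=> //; reflexivity.
rewrite ltnS inE negb_or => szu /andP[sr su] comm.
have rs : r != s by rewrite eq_sym.
(* If [u] crosses the wall of [r], exchange yields a shorter word for [r :: u], and induction
   applies to it. Otherwise [r :: u] crosses that wall an odd number of times. *)
have [/exchange[u' [ssu szu' E]]|ur] := boolP (eta u [:: r]).
  have E' : u' ≃ r :: u by rewrite E; reflexivity.
  have sub : {subset u' <= u} by apply: mem_subseq.
  have [||v [vu' vsub vP]] := IH u' (ltn_trans szu' szu).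
  - by apply: contra su => /sub.
  - by rewrite E'; exact: comm.
  exists v; split=> //; first by rewrite vu'.
  by move=> x /vsub/sub xu; rewrite inE xu orbT.
have rur : eta (r :: u) [:: r].
  rewrite /= asboolT /=; last reflexivity.
  by rewrite (eta_congr u (letterK r [:: r])).
have Pru : all (predC1 s) (r :: u) by rewrite notin_all // inE negb_or sr.
have eq2 : m r s = 2.
  apply: conj_letter_represented => //; apply: contrapT => nrep.
  have := eta_cox_eq [:: r] (comm : [:: s] ++ r :: u ≃ (r :: u) ++ [:: s]).
  rewrite !eta_cat rur (eta_unrepresented Pru); last exact: nrep.
  rewrite /= !asboolF //=.
    move=> E; apply: (@letter_unrepresented s); exists (rev u ++ r :: r :: r :: u).
      have Psu := notin_all su.
      by rewrite all_cat all_rev Psu /= !rs.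
    rewrite E rev_cons -cats1 -!catA; reflexivity.
  by move=> E; apply: (@letter_unrepresented s); exists [:: r] => /=; [rewrite rs|symmetry].
have srrs : [:: s] ++ [:: r] ≃ [:: r] ++ [:: s].
  have R := relator1 r s; rewrite /relator eq2 in R.
  apply: (mulI (g := [:: r; s])); change ([:: r; s] ++ rev [:: r; s] ≃ [:: r; s; r; s]).
  by rewrite mulKrev0; symmetry.
have [//||v [vu vsub vP]] := IH u szu.
  apply: (mulI (g := [:: r])); rewrite catA -srrs -catA.
  by change ([:: s] ++ r :: u ≃ (r :: u) ++ [:: s]).
exists (r :: v); split=> /=; first by rewrite vu; reflexivity.
  by move=> x; rewrite !inE => /orP[->//|/vsub ->]; rewrite orbT.
by rewrite eq2 eqxx.
Qed.

(** * Torsion of the abelian subgroup inside proper parabolic subgroups *)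

Section AbelianSubgroup.
Variable H : seq I -> Prop.
Hypothesis H_congr : forall u v, u ≃ v -> H u -> H v.
Hypothesis HM : forall u v, H u -> H v -> H (u ++ v).
Hypothesis HV : forall u, H u -> H (rev u).
Hypothesis HJ : forall g h, H h -> H (g ++ h ++ rev g).
Hypothesis HC : forall u v, H u -> H v -> u ++ v ≃ v ++ u.

Definition conj_letter g s := g ++ [:: s] ++ rev g.

Lemma HJletter s x : H x -> H ([:: s] ++ x ++ [:: s]).
Proof. exact: (HJ [:: s]). Qed.

(* x and s x s both lie in H, hence commute. *)
Lemma conj_letter_letter s x : H x ->
  [:: s] ++ conj_letter x s ++ [:: s] ≃ conj_letter (rev x) s.
Proof.
move=> Hx; rewrite /conj_letter revK.
have E := HC (HJletter s Hx) (HV Hx).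
have -> : [:: s] ++ (x ++ [:: s] ++ rev x) ++ [:: s] =
  (([:: s] ++ x ++ [:: s]) ++ rev x) ++ [:: s] by rewrite -!catA.
by rewrite E -!catA letter_sqr cats0; reflexivity.
Qed.

Lemma conj_letter_unrepresented g s :
  s \notin g -> ~ represented (predC1 s) (conj_letter g s).
Proof.
move=> /notin_all Pg [v Pv E]; apply: (@letter_unrepresented s).
exists (rev g ++ v ++ g); first by rewrite !all_cat all_rev Pg Pv.
by rewrite E /conj_letter -!catA mulrevK mulrevK0 cats0; reflexivity.
Qed.

(** Only the middle letter can contribute: the two outer factors avoid [s], while the walls tested
    against them have reflections outside the parabolic subgroup omitting [s]. *)
Lemma eta_conj_letter s g g' : H g -> H g' -> s \notin g -> s \notin g' ->
  eta (conj_letter g s) (conj_letter g' s) =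
  `[< conj_letter g s ≃ conj_letter g' s >].
Proof.
move=> Hg Hg' sg sg'; rewrite {1}/conj_letter !eta_cat.
rewrite (eta_unrepresented (notin_all sg)); last exact: conj_letter_unrepresented.
rewrite addFb; set t := rev g ++ _ ++ g.
have tE : t = conj_letter (rev g ++ g') s.
  by rewrite /t /conj_letter rev_cat revK -!catA.
have -> : eta [:: s] t = `[< [:: s] ≃ t >] by rewrite /= addbF.
have -> : eta (rev g) (rev [:: s] ++ t ++ [:: s]) = false.
  rewrite tE (eta_congr _ (conj_letter_letter s (HM (HV Hg) Hg'))).
  apply: (eta_unrepresented (P := predC1 s)); first by rewrite all_rev notin_all.
  by apply: conj_letter_unrepresented; rewrite mem_rev mem_cat mem_rev negb_or sg.
rewrite addbF; apply: asbool_equiv_eq; split=> [E|E].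
  rewrite {1}/conj_letter E /t -!catA mulKrev mulKrev0 cats0; reflexivity.
by rewrite /t -E /conj_letter -!catA mulrevK mulrevK0 cats0; reflexivity.
Qed.

(* Put t_n = h^n s h^-n.  Since H is abelian, t_1 t_0 t_1 = t_2; comparing
   whether both sides separate the identity from the wall of t_1 gives
   t_1 = t_(-1). *)
Lemma sqr_commutes s h : H h -> s \notin h ->
  [:: s] ++ h ++ h ≃ (h ++ h) ++ [:: s].
Proof.
move=> Hh sh; set t1 := conj_letter h s.
have Hhh : H (h ++ h) by exact: HM.
have shh : s \notin h ++ h by rewrite mem_cat negb_or sh.
have srh : s \notin rev h by rewrite mem_rev.
have t2E : t1 ++ [:: s] ++ t1 ≃ conj_letter (h ++ h) s.
  have E := HC (HJletter s (HV Hh)) Hh.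
  have -> : t1 ++ [:: s] ++ t1 =
    h ++ [:: s] ++ (rev h ++ [:: s] ++ h ++ [:: s] ++ rev h).
    by rewrite /t1 /conj_letter -!catA.
  have -> : h ++ [:: s] ++ rev h ++ [:: s] ++ h ++ [:: s] ++ rev h =
    h ++ (([:: s] ++ rev h ++ [:: s]) ++ h) ++ [:: s] ++ rev h by rewrite -!catA.
  rewrite E /conj_letter rev_cat -!catA letterK; reflexivity.
have t1K : rev t1 ++ t1 ++ t1 ≃ t1 by exact: mulrevK.
(* On the left the three factors contribute 1, [t_0 = t_1] and [t_1 = t_(-1)]; the right side is
   [t_2 = t_1]. *)
have := eta_cox_eq t1 t2E.
rewrite (eta_cat t1) (eta_cat [:: s]) (eta_congr [:: s] t1K).
rewrite (eta_congr t1 (cox_eq_ctx (rev [:: s]) [:: s] t1K)).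
rewrite (eta_congr t1 (conj_letter_letter s Hh)).
rewrite !eta_conj_letter //; last exact: HV.
rewrite asboolT; last reflexivity.
(* Conjugation by [h] carries t_0 = t_1 to t_1 = t_2, so these two terms cancel. *)
rewrite (_ : `[< conj_letter (h ++ h) s ≃ t1 >] = eta [:: s] t1); last first.
  have -> : conj_letter (h ++ h) s = h ++ t1 ++ rev h.
    by rewrite /t1 /conj_letter rev_cat -!catA.
  rewrite [RHS]/= addbF; apply: asbool_equiv_eq; split=> E; last first.
    change (h ++ t1 ++ rev h ≃ h ++ [:: s] ++ rev h); rewrite E; reflexivity.
  symmetry; apply: (mulI (g := h)); apply: (mulIr (g := rev h)).
  rewrite -catA E /t1 /conj_letter -catA; reflexivity.
case: (eta [:: s] t1) => //=; case: asboolP => // {t2E} E _.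
all: apply: (mulIr (g := rev h)); apply: (mulI (g := rev h)).
all: change (rev h ++ ([:: s] ++ h ++ h) ++ rev h ≃ rev h ++ ((h ++ h) ++ [:: s]) ++ rev h).
all: rewrite -!catA mulrevK mulKrev0 cats0.
all: change (rev h ++ [:: s] ++ h ≃ conj_letter h s).
all: by rewrite E /conj_letter revK; reflexivity.
Qed.


Lemma letter_elimination h (A : {set I}) s r : H h -> {subset h <= A} ->
  s \notin A -> m r s != 2 -> exists2 h', h' ≃ h ++ h & {subset h' <= A :\ r}.
Proof.
move=> Hh hA sA mrs.
have sh : s \notin h by apply: contra sA; exact: hA.
have [||h' [E h'h h'P]] := @commuting_letters s (h ++ h).
- by rewrite mem_cat negb_or sh.
- exact: sqr_commutes.
exists h' => // x xh'; rewrite !inE; apply/andP; split; last first.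
  by apply: hA; have := h'h _ xh'; rewrite mem_cat orbb.
by apply: contraNneq mrs => <-; exact: (allP h'P).
Qed.

Definition wpow n g := flatten (nseq n g).

Lemma wpowS n g : wpow n.+1 g = g ++ wpow n g. Proof. by []. Qed.

#[local] Instance wpow_proper n : Proper (cox_eq m ==> cox_eq m) (wpow n).
Proof.
move=> g g' gg; elim: n => [|n IH]; first reflexivity.
exact: (cat_proper gg IH).
Qed.

Hypothesis irr : irreducible m.

Lemma exit_edge (A : {set I}) : A != set0 -> A != setT ->
  exists s r, [/\ s \notin A, r \in A & m r s != 2].
Proof.
case/set0Pn => a aA; rewrite -properT properE => /andP[_ /subsetPn[b _ bA]].
apply: contrapT => noedge.
suff cl : closed (coxeter_graph m) A.
  by have := closed_connect cl (irr a b); rewrite aA (negPf bA).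
have half x y : coxeter_graph m x y -> x \in A -> y \in A.
  move=> /andP[_ mxy] xA; apply: contraT => yA; case: noedge.
  by exists y, x.
move=> x y xy; apply/idP/idP; first exact: half.
by apply: half; move: xy; rewrite /coxeter_graph eq_sym mC.
Qed.

Lemma wpow2 n g : wpow n (g ++ g) = wpow n.*2 g.
Proof. by elim: n => // n IH; rewrite doubleS !wpowS IH catA. Qed.

(** Each squaring removes from [A] a letter joined to some [s] outside [A]; the smaller set still
    omits [s], so the induction continues down to the empty word. *)
Lemma parabolic_torsion h (A : {set I}) :
  H h -> {subset h <= A} -> A != setT -> wpow (2 ^ #|A|) h ≃ [::].
Proof.
have [n] := ubnP #|A|; elim: n => // n IH in h A * => cA Hh hA AT.
have [A0|/exit_edge/(_ AT)[s [r [sA rA mrs]]]] := eqVneq A set0.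
  case: h hA {Hh} => [_|x h /(_ x)]; last by rewrite A0 !inE eqxx => /(_ isT).
  by elim: (2 ^ _) => [|k IHk]; [reflexivity|exact: IHk].
have [h' E h'A] := letter_elimination Hh hA sA mrs.
have Hh' : H h' by apply: (H_congr (u := h ++ h)); [symmetry|exact: HM].
have cA' : #|A :\ r|.+1 = #|A| by rewrite (cardsD1 r A) rA.
rewrite -cA' expnSr muln2 -wpow2 -E; apply: IH => //; first by rewrite -ltnS cA'.
by apply/negP => /eqP/setP/(_ s); rewrite !inE (negPf sA) andbF.
Qed.

(** An exponent independent of [h] and [s] fixes in advance how many factors to delete. *)
Lemma parabolic_torsion_uniform h s :
  H h -> s \notin h -> wpow (2 ^ #|I|.-1) h ≃ [::].
Proof.
move=> Hh sh; rewrite -[#|I|](cardsT I) (cardsD1 s) inE add1n succnK.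
apply: parabolic_torsion => //.
- by move=> x xh; rewrite !inE andbT; apply: contraNneq sh => <-.
- by apply/negP => /eqP/setP/(_ s); rewrite !inE eqxx.
Qed.

(** * Bounding reduced words that avoid a letter *)

Variable L : seq (seq I).
Hypothesis HL : forall g, exists2 l, l \in L & H (rev l ++ g).

Lemma coset_index_ex g : exists i : 'I_(size L), H (rev (nth [::] L i) ++ g).
Proof.
have [l lL Hl] := HL g.
have il : index l L < size L by rewrite index_mem.
by exists (Ordinal il); rewrite nth_index.
Qed.

Definition coset_index g : 'I_(size L) := projT1 (cid (coset_index_ex g)).

Lemma coset_indexP g g' : coset_index g = coset_index g' -> H (rev g ++ g').
Proof.
rewrite /coset_index; case: (cid _) => i Hi; case: (cid _) => j Hj /= ij.
move: Hj; rewrite -{}ij => Hj.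
apply: H_congr (HM (HV Hi) Hj).
rewrite rev_cat revK -!catA; set l := nth _ _ _; rewrite mulKrev; reflexivity.
Qed.

(** As the subgroup is abelian, conjugation on it depends only on the coset of the conjugating
    element. *)
Lemma conj_coset g g' a : coset_index g = coset_index g' -> H a ->
  g ++ a ++ rev g ≃ g' ++ a ++ rev g'.
Proof.
move=> /coset_indexP Hg Ha; apply: (mulI (g := rev g)); rewrite mulrevK.
apply: (mulIr (g := g)); rewrite -!catA mulrevK0 cats0.
have E := HC Hg Ha.
rewrite (catA (rev g)) (catA (rev g ++ g')) E -!catA.
by rewrite mulKrev mulrevK0 cats0; reflexivity.
Qed.

Definition words n : seq (seq I) :=
  flatten [seq [seq val t | t : k.-tuple I] | k <- iota 0 n.+1].

Lemma mem_words n u : size u <= n -> u \in words n.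
Proof.
move=> un; apply/flatten_mapP; exists (size u); first by rewrite mem_iota.
by apply/mapP; exists (in_tuple u) => //; rewrite mem_enum.
Qed.

(** Two of the [size L + 1] prefixes share a coset index; the factor between them lies in [H]. *)
Lemma repeated_coset p b : size b = size L -> exists b1 a b2,
  [/\ b = b1 ++ a ++ b2, 0 < size a & H a].
Proof.
move=> sb; pose f (k : 'I_(size L).+1) := coset_index (p ++ take k b).
have : ~~ injectiveb f.
  by apply/negP => /injectiveP/leq_card; rewrite !card_ord ltnn.
case/injectivePn => x [y xy fxy].
wlog xy' : x y xy fxy / x < y.
  move=> W; case: (ltngtP x y) => [|/W|/val_inj E]; first exact: W.
    by apply=> //; rewrite eq_sym.
  by rewrite E eqxx in xy.
have yb : y <= size b by rewrite sb -ltnS.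
have xyb : take x (take y b) = take x b by rewrite take_takel // ltnW.
exists (take x b), (drop x (take y b)), (drop y b); split.
- by rewrite catA -xyb cat_take_drop cat_take_drop.
- by rewrite size_drop size_takel // subn_gt0.
apply: H_congr (coset_indexP fxy).
have -> : take y b = take x b ++ drop x (take y b) by rewrite -xyb cat_take_drop.
rewrite drop_size_cat ?size_takel //; last by rewrite ltnW // (leq_trans xy').
by rewrite !rev_cat -!catA !mulrevK; reflexivity.
Qed.

Lemma pigeonhole (T : finType) (f : nat -> T) M N :
  #|T| * M < N -> exists z, M < \sum_(k < N) (f k == z).
Proof.
move=> TMN; apply: contrapT => small.
suff : N <= #|T| * M by rewrite leqNgt TMN.
have -> : N = \sum_(k < N) \sum_(z : T) (f k == z).
  rewrite (eq_bigr (fun=> 1)) ?sum_nat_const ?card_ord ?muln1 // => k _.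
  rewrite (bigD1 (f k)) //= eqxx big1 // => z.
  by rewrite eq_sym => /negPf ->.
rewrite -sum_nat_const exchange_big; apply: leq_sum => z _; rewrite leqNgt.
by apply/negP => ?; apply: small; exists z.
Qed.

(* In a long word avoiding s many windows contain a nonempty factor lying in H;
   many of these factors are the same word a preceded by prefixes in the same
   coset, so their conjugates by the prefixes are one element g of finite order
   M; deleting M of the factors then does not change the element. *)
Lemma reduced_avoiding_bounded :
  exists N, forall s u, reduced m u -> s \notin u -> size u < N.
Proof.
(* A tag records the coset index of the prefix before a factor, and the factor itself. With [N]
   windows of length [D], some tag occurs more than [M] times. *)
pose D := size L; pose tag := ('I_D * seq_sub (words D))%type.
pose M := 2 ^ #|I|.-1; pose N := (#|{: tag}| * M).+1.
exists (N * D) => s u red su; rewrite ltnNge; apply/negP => long.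
(* The guard [k < N] lets choice produce a total function; its values beyond [N] are arbitrary. *)
pose R k (z : tag) := k < N -> exists b1 b2,
  [/\ take D (drop (k * D) u) = b1 ++ val z.2 ++ b2,
      0 < size (val z.2), H (val z.2) & coset_index (take (k * D) u ++ b1) = z.1].
have window k : k < N -> exists z, R k z.
  move=> kN; have szb : size (take D (drop (k * D) u)) = D.
    rewrite size_takel // size_drop leq_subRL.
      by rewrite -mulSnr (leq_trans _ long) // leq_mul2r kN orbT.
    by rewrite (leq_trans _ long) // leq_mul2r ltnW ?orbT.
  have [b1 [a [b2 [E a0 Ha]]]] := repeated_coset [::] szb.
  have aD : a \in words D.
    by apply: mem_words; rewrite -szb E !size_cat addnCA leq_addr.
  by exists (coset_index (take (k * D) u ++ b1), SeqSub aD) => _; exists b1, b2.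
have [z0 _] := window 0 isT.
have /choice[f fP] : forall k, exists z, R k z.
  move=> k; case: (ltnP k N) => [/window //|kN]; exists z0.
  by rewrite /R ltnNge kN.
have [z tM] := pigeonhole f (ltnSn _ : #|{: tag}| * M < N).
pose c n := \sum_(k < n) (f k == z).
have cS n : c n.+1 = c n + (f n == z) by rewrite /c big_ord_recr.
(* The count grows by at most one per window, so it takes the value [M] exactly. *)
have [n [nN cn]] : exists n, n <= N /\ c n = M.
  have ex : exists n, M <= c n by exists N; apply: ltnW.
  case: (ex_minnP ex) => n Mn nmin; exists n; split.
    by apply: nmin; apply: ltnW.
  apply/eqP; rewrite eqn_leq Mn andbT.
  case: n Mn nmin => [|n] Mn nmin; first by rewrite /c big_ord0.
  rewrite cS; case: (leqP M (c n)) => [/nmin|cM]; first by rewrite ltnn.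
  by rewrite (leq_trans _ cM) // -addn1 leq_add2l leq_b1.
have M0 : 0 < M by rewrite expn_gt0.
have [g [Hg sg gP]] : exists g, [/\ H g, s \notin g & forall p, coset_index p = z.1 ->
    p ++ val z.2 ++ rev p ≃ g].
  have [k kN /eqP fk] : exists2 k, k < N & f k == z.
    apply: contrapT => none; move: tM; rewrite big1 // => k _.
    by apply/eqP; rewrite eqb0; apply/negP => fk; apply: none; exists k.
  have [b1 [b2]] := fP k kN; rewrite fk => -[E a0 Ha ct].
  pose p := take (k * D) u ++ b1.
  exists (p ++ val z.2 ++ rev p); split; first exact: HJ.
    have sub : {subset b1 ++ val z.2 ++ b2 <= u}.
      by move=> x; rewrite -E => /mem_take/mem_drop.
    apply: contra su; rewrite /p !mem_cat mem_rev !mem_cat.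
    have b1u x : x \in b1 -> x \in u by move=> xb; apply: sub; rewrite mem_cat xb.
    have au x : x \in val z.2 -> x \in u.
      by move=> xa; apply: sub; rewrite !mem_cat xa orbT.
    by case/or3P => [/orP[/mem_take|/b1u]|/au|/orP[/mem_take|/b1u]].
  by move=> q cq; apply: conj_coset => //; rewrite cq ct.
(* Each chosen factor is moved to the front, where it becomes its conjugate [g]; as it is nonempty,
   [v] loses at least one letter each time. *)
have [v vE szv] : exists2 v, take (n * D) u ≃ wpow (c n) g ++ v & size v + c n <= n * D.
  elim: n nN {cn} => [|n IH] nN.
    by exists [::]; rewrite ?take0 /c ?big_ord0 //; reflexivity.
  have [v vE szv] := IH (ltnW nN); have [b1 [b2 [E a0 Ha ct]]] := fP n nN.
  have TE : take (n.+1 * D) u = take (n * D) u ++ b1 ++ val (f n).2 ++ b2.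
    by rewrite -E mulSnr takeD.
  have szE : size (b1 ++ val (f n).2 ++ b2) <= D by rewrite -E size_take_min geq_minl.
  rewrite TE cS; have [fn|_] := eqVneq (f n) z; last first.
    exists (v ++ b1 ++ val (f n).2 ++ b2); first by rewrite vE addn0 -!catA; reflexivity.
    by rewrite size_cat addn0 addnAC mulSnr leq_add.
  exists (v ++ b1 ++ b2).
    rewrite fn in ct *; rewrite addn1 wpowS -(catA g) (catA (wpow _ _)) -vE -(gP _ ct).
    rewrite -(catA (_ ++ b1)) -(catA (val _)) !(catA (take _ _) b1) mulrevK.
    reflexivity.
  move: szE; rewrite !size_cat mulSnr addn1 => szE.
  rewrite addnAC addnS addSn -addnS leq_add // (leq_trans _ szE) //.
  by rewrite -addnS leq_add2l -add1n leq_add2r.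
have vu : u ≃ v ++ drop (n * D) u.
  rewrite -{1}(cat_take_drop (n * D) u) vE cn (parabolic_torsion_uniform Hg sg).
  reflexivity.
have := red _ vu; rewrite leqNgt -{2}(cat_take_drop (n * D) u) !size_cat ltn_add2r.
rewrite size_takel; last by rewrite (leq_trans _ long) // leq_mul2r nN orbT.
by rewrite cn in szv; rewrite (leq_trans _ szv) // -addn1 leq_add2l.
Qed.

End AbelianSubgroup.

(** * Subwords of long reduced words *)

Lemma reduced_exists w : exists2 u, reduced m u & u ≃ w.
Proof.
have [n] := ubnP (size w); elim: n w => // n IH w; rewrite ltnS => szw.
have [redw|/existsNP[v /not_implyP[wv /negP]]] := pselect (reduced m w).
  by exists w => //; reflexivity.
rewrite -ltnNge => szv; have [u ru uv] := IH v (leq_trans szv szw).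
by exists u => //; rewrite uv wv; reflexivity.
Qed.

Lemma reduced_factor a b u : reduced m (a ++ u ++ b) -> reduced m u.
Proof.
move=> red v uv; have := red (a ++ v ++ b) (cox_eq_ctx a b uv).
by rewrite !size_cat leq_add2l leq_add2r.
Qed.

(** Successive letters of [x] are found in successive blocks of [N] letters, since each block is
    reduced and too long to miss a letter. *)
Lemma subseq_long_reduced N :
  (forall s u, reduced m u -> s \notin u -> size u < N) ->
  forall x u, reduced m u -> N * size x <= size u -> subseq x u.
Proof.
move=> bounded; elim=> [|i x IH] u red szu; first exact: sub0seq.
have Nu : N <= size u by rewrite (leq_trans _ szu) // mulnS leq_addr.
rewrite -(cat_take_drop N u) -cat1s cat_subseq //.
  rewrite sub1seq; apply: contraT => iN.
  have := bounded i (take N u) _ iN; rewrite size_takel // ltnn; apply.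
  by apply: (@reduced_factor [::] (drop N u)); rewrite cat_take_drop.
apply: IH; last by rewrite size_drop leq_subRL // -mulnS.
by apply: (@reduced_factor (take N u) [::]); rewrite cats0 cat_take_drop.
Qed.

End Words.

Theorem theorem1p2 (I : finType) (m : I -> I -> nat) (w : seq I) :
  affine_coxeter m -> finite_in_W m (Annex m w).
Proof.
case=> mP irr _ [H [Hcongr [_ [HM [HV [HJ [HC [L HL]]]]]]]].
have [N bounded] := reduced_avoiding_bounded mP Hcongr HM HV HJ HC irr HL.
have [x redx xw] := reduced_exists m w.
exists (words I (N * size x)) => y wy.
have [u redu uy] := reduced_exists m y.
exists u => //; apply: mem_words; rewrite leqNgt; apply/negP => /ltnW szu.
apply: wy; exists u; split=> //; exists x; split=> //.
exact: subseq_long_reduced bounded _ _ redu szu.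
Qed.
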